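(* Consider the fully discrete Crank–Nicolson ensemble scheme described in the context, with homogeneous Dirichlet boundary conditions and with forcing terms equal to zero, i.e. $\boldsymbol f_{j,h}^{n+1/2}=0$ and $\nabla\times\boldsymbol g_{j,h}^{n+1/2}=0$ for all $j$ and $n$. Then the scheme is unconditionally stable with respect to the modified energy $\mathcal F(R_j)$: for every time step $\Delta t>0$ (with no restriction relating $\Delta t$ to $h$ or to the other parameters), every $j\in\{1,\dots,J\}$ and every $n\ge 0$, any solution of the scheme satisfies $$0<\mathcal F(R_{j,h}^{n+1})\le \mathcal F(R_{j,h}^{n}).$$
   Context: Setting. $\Omega\subset\mathbb R^d$ ($d=2,3$) is a bounded domain with boundary $\Gamma$; $(\cdot,\cdot)$ and $\|\cdot\|$ are the $L^2(\Omega)$ inner product and norm. $X=H_0^1(\Omega)^d$, $Q=L_0^2(\Omega)$ (mean-zero $L^2$ functions), and $X_h\subset X$, $Q_h\subset Q$ are conforming finite element spaces with mesh size $h$ satisfying the discrete inf-sup condition. Let $b^*(u,v,w)=\frac12(u\cdot\nabla v,w)-\frac12(u\cdot\nabla w,v)$. For $j=1,\dots,J$, let $\nu_j>0$ (kinematic viscosity) and $\gamma_j>0$ (magnetic resistivity) be constants, and set $\bar\nu=\frac1J\sum_{j}\nu_j$, $\bar\gamma=\frac1J\sum_j\gamma_j$, $\nu_j'=\nu_j-\bar\nu$, $\gamma_j'=\gamma_j-\bar\gamma$. The constant $s>0$ is the coupling number, $\alpha,\alpha_M\ge 0$ are regularization constants, and $\Delta t>0$. Energy and auxiliary variable. $E(\boldsymbol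 u,\boldsymbol B)=\frac12\|\boldsymbol u\|^2+\frac s2\|\boldsymbol B\|^2+C_0$ with $C_0>0$ a fixed constant. $\mathcal F$ is a one-to-one increasing differentiable function with inverse $\mathcal G=\mathcal F^{-1}$, both defined at least on $(0,\infty)$, with $\mathcal F(\chi)>0$ and $\mathcal G(\chi)>0$ for all $\chi>0$. The scalar variable is initialized as $R_{j,h}^0=\mathcal G(E(\boldsymbol u_j^0,\boldsymbol B_j^0))$, where $\boldsymbol u_j^0,\boldsymbol B_j^0$ are the initial data. Notation. For a sequence $v^n$: $v^{n+1/2}=\frac12(v^{n+1}+v^n)$ and $\tilde v^{n+1/2}=2v^{n-1/2}-v^{n-3/2}$. The values at indices $\le 0$ needed to start the scheme are given elements of the discrete spaces. Scheme. Given the previous values, for each $j$ find $\boldsymbol u_{j,h}^{n+1},\boldsymbol B_{j,h}^{n+1}\in X_h$, $p_{j,h}^{n+1},\lambda_{j,h}^{n+1}\in Q_h$ and a scalar $R_{j,h}^{n+1}$ such that for all $\boldsymbol v_h,\boldsymbol\chi_h\in X_h$, $l_h,\psi_h\in Q_h$ (writing $\tilde{\boldsymbol u}=\tilde{\boldsymbol u}_{j,h}^{n+1/2}$, $\tilde{\boldsymbol B}=\tilde{\boldsymbol B}_{j,h}^{n+1/2}$): (1) $\left(\frac{\boldsymbol u_{j,h}^{n+1}-\boldsymbol u_{j,h}^n}{\Delta t},\boldsymbol v_h\right)=-\xi_j b^*(\tilde{\boldsymbol u},\tilde{\boldsymbol u},\boldsymbol v_h)+s\xi_j b^*(\tilde{\boldsymbol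 B},\tilde{\boldsymbol B},\boldsymbol v_h)-\bar\nu(\nabla\boldsymbol u_{j,h}^{n+1/2},\nabla\boldsymbol v_h)-\nu_j'(\nabla\tilde{\boldsymbol u},\nabla\boldsymbol v_h)+(p_{j,h}^{n+1/2},\nabla\cdot\boldsymbol v_h)-\alpha h(\nabla(\boldsymbol u_{j,h}^{n+1}-\boldsymbol u_{j,h}^n),\nabla\boldsymbol v_h)+(\boldsymbol f_{j,h}^{n+1/2},\boldsymbol v_h)$, and $(\nabla\cdot\boldsymbol u_{j,h}^{n+1},l_h)=0$; (2) $\left(\frac{\boldsymbol B_{j,h}^{n+1}-\boldsymbol B_{j,h}^n}{\Delta t},\boldsymbol\chi_h\right)=\xi_j b^*(\tilde{\boldsymbol B},\tilde{\boldsymbol u},\boldsymbol\chi_h)-\xi_j b^*(\tilde{\boldsymbol u},\tilde{\boldsymbol B},\boldsymbol\chi_h)-\bar\gamma(\nabla\boldsymbol B_{j,h}^{n+1/2},\nabla\boldsymbol\chi_h)-\gamma_j'(\nabla\tilde{\boldsymbol B},\nabla\boldsymbol\chi_h)+(\lambda_{j,h}^{n+1/2},\nabla\cdot\boldsymbol\chi_h)-\alpha_M h(\nabla(\boldsymbol B_{j,h}^{n+1}-\boldsymbol B_{j,h}^n),\nabla\boldsymbol\chi_h)+(\nabla\times\boldsymbol g_{j,h}^{n+1/2},\boldsymbol\chi_h)$, and $(\nabla\cdot\boldsymbol B_{j,h}^{n+1},\psi_h)=0$; (3) $\xi_j=\dfrac{\mathcal F(R_{j,h}^{n+1})}{E(\bar{\boldsymbol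 u}_{j,h}^{n+1},\bar{\boldsymbol B}_{j,h}^{n+1})}$; (4) $\dfrac{\mathcal F(R_{j,h}^{n+1})-\mathcal F(R_{j,h}^{n})}{\Delta t}=\left(\frac{\boldsymbol u_{j,h}^{n+1}-\boldsymbol u_{j,h}^n}{\Delta t},\boldsymbol u_{j,h}^{n+1/2}\right)+s\left(\frac{\boldsymbol B_{j,h}^{n+1}-\boldsymbol B_{j,h}^n}{\Delta t},\boldsymbol B_{j,h}^{n+1/2}\right)$ $+\xi_j b^*(\tilde{\boldsymbol u},\tilde{\boldsymbol u},\boldsymbol u_{j,h}^{n+1/2})-s\xi_j b^*(\tilde{\boldsymbol B},\tilde{\boldsymbol B},\boldsymbol u_{j,h}^{n+1/2})+\bar\nu\|\nabla\boldsymbol u_{j,h}^{n+1/2}\|^2+\nu_j'(\nabla\tilde{\boldsymbol u},\nabla\boldsymbol u_{j,h}^{n+1/2})-(p_{j,h}^{n+1/2},\nabla\cdot\boldsymbol u_{j,h}^{n+1/2})+\alpha h(\nabla(\boldsymbol u_{j,h}^{n+1}-\boldsymbol u_{j,h}^n),\nabla\boldsymbol u_{j,h}^{n+1/2})-(\boldsymbol f_{j,h}^{n+1/2},\boldsymbol u_{j,h}^{n+1/2})$ $-s\xi_j b^*(\tilde{\boldsymbol B},\tilde{\boldsymbol u},\boldsymbol B_{j,h}^{n+1/2})+s\xi_j b^*(\tilde{\boldsymbol u},\tilde{\boldsymbol B},\boldsymbol B_{j,h}^{n+1/2})+s\bar\gamma\|\nabla\boldsymbol B_{j,h}^{n+1/2}\|^2+s\gamma_j'(\nabla\tilde{\boldsymbol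 B},\nabla\boldsymbol B_{j,h}^{n+1/2})-s(\lambda_{j,h}^{n+1/2},\nabla\cdot\boldsymbol B_{j,h}^{n+1/2})+s\alpha_M h(\nabla(\boldsymbol B_{j,h}^{n+1}-\boldsymbol B_{j,h}^n),\nabla\boldsymbol B_{j,h}^{n+1/2})-s(\nabla\times\boldsymbol g_{j,h}^{n+1/2},\boldsymbol B_{j,h}^{n+1/2})$ $+\xi_j\left[-\int_\Omega(\nu_j|\nabla\bar{\boldsymbol u}_{j,h}^{n+1/2}|^2+s\gamma_j|\nabla\bar{\boldsymbol B}_{j,h}^{n+1/2}|^2)\,d\Omega+S_0\right]+(1-\xi_j)|S_0|$, where $S_0=\int_\Omega\boldsymbol f_{j,h}^{n+1/2}\cdot\bar{\boldsymbol u}_{j,h}^{n+1/2}\,d\Omega+\int_\Omega s(\nabla\times\boldsymbol g_{j,h}^{n+1/2})\cdot\bar{\boldsymbol B}_{j,h}^{n+1/2}\,d\Omega$ (the additional boundary integral present for general boundary data vanishes for homogeneous Dirichlet conditions). Here $\bar{\boldsymbol u}_{j,h}^{n+1},\bar{\boldsymbol B}_{j,h}^{n+1}\in X_h$ are the second-order approximations obtained by writing the solution of (1)–(2) as $\boldsymbol u_{j,h}^{n+1}=\hat{\boldsymbol u}+\xi_j\breve{\boldsymbol u}$, $\boldsymbol B_{j,h}^{n+1}=\hat{\boldsymbol B}+\xi_j\breve{\boldsymbol B}$ with $\hat{\ },\breve{\ }$ independent of $\xi_j$, and setting $\bar{\boldsymbol u}_{j,h}^{n+1}=\hat{\boldsymbol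 u}+\breve{\boldsymbol u}$, $\bar{\boldsymbol B}_{j,h}^{n+1}=\hat{\boldsymbol B}+\breve{\boldsymbol B}$ (i.e. the solution of (1)–(2) with $\xi_j$ replaced by $1$); and $\bar{\boldsymbol u}_{j,h}^{n+1/2}=\frac12(\bar{\boldsymbol u}_{j,h}^{n+1}+\boldsymbol u_{j,h}^n)$, $\bar{\boldsymbol B}_{j,h}^{n+1/2}=\frac12(\bar{\boldsymbol B}_{j,h}^{n+1}+\boldsymbol B_{j,h}^n)$. *)

(* Defs.v *)
From HB Require Import structures.
From mathcomp Require Import all_boot all_order all_algebra.
From mathcomp Require Import all_classical all_reals all_analysis.
Set Implicit Arguments.
Unset Strict Implicit.
Unset Printing Implicit Defensive.
Import Order.TTheory GRing.Theory Num.Theory.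
Import numFieldNormedType.Exports.
Local Open Scope classical_set_scope.
Local Open Scope ring_scope.

Definition rV_display : measure_display -> measure_display.
Proof. exact. Qed.

Section measurable_rV.
Context {d} {T : sigmaRingType d}.
Variable n : nat.

Let coord (i : 'I_n) (x : 'rV[T]_n) : T := x ord0 i.

Let rV_set0 : g_sigma_preimage coord set0.
Proof. exact: sigma_algebra0. Qed.

Let rV_setC A : g_sigma_preimage coord A -> g_sigma_preimage coord (~` A).
Proof. exact: sigma_algebraC. Qed.

Let rV_bigcup (F : _^nat) : (forall i, g_sigma_preimage coord (F i)) ->
  g_sigma_preimage coord (\bigcup_i (F i)).
Proof. exact: sigma_algebra_bigcup. Qed.

HB.instance Definition _ := @isMeasurable.Build (rV_display d)
  'rV[T]_n (g_sigma_preimage coord) rV_set0 rV_setC rV_bigcup.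
End measurable_rV.


Section lebesgue_rV.
Context {R : realType}.

Definition rV_cons n (p : measurableTypeR R * 'rV[R]_n) : 'rV[R]_n.+1 :=
  \row_i oapp (p.2 ord0) p.1 (unlift ord0 i).

Lemma measurable_rV_coord n (i : 'I_n) :
  measurable_fun setT (fun x : 'rV[R]_n => x ord0 i).
Proof.
move=> _ Y mY; rewrite setTI; apply: sub_sigma_algebra => /=.
rewrite -bigcup_seq/=; exists i => /=; first by rewrite mem_index_enum.
by exists Y => //; rewrite setTI.
Qed.

Lemma measurable_rV_cons n : measurable_fun setT (@rV_cons n).
Proof.
apply: measurability => //= A [B].
rewrite -bigcup_seq => -[i _ [Y mY <-]] <-; rewrite !setTI.
rewrite -comp_preimage.
have -> : (fun x : 'rV[R]_n.+1 => x ord0 i) \o @rV_cons n =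
    (fun p => oapp (p.2 ord0) p.1 (unlift ord0 i)).
  by apply/funext => p /=; rewrite mxE.
rewrite -[X in measurable X]setTI.
case: unliftP => [j _|_] /=; last exact: measurable_fst.
suff : measurable_fun setT (fun p : measurableTypeR R * 'rV[R]_n => p.2 ord0 j) by apply.
exact: measurableT_comp (measurable_rV_coord j) measurable_snd.
Qed.

Section step.
Variables (n : nat) (mu : {sigma_finite_measure set 'rV[R]_n -> \bar R}).

Definition lebesgue_rV_step (A : set 'rV[R]_n.+1) : \bar R :=
  pushforward (@lebesgue_measure R \x mu)%E (@rV_cons n) A.

Let step0 : lebesgue_rV_step set0 = 0%E.
Proof. by rewrite /lebesgue_rV_step /pushforward preimage_set0 measure0. Qed.

Let step_ge0 A : (0 <= lebesgue_rV_step A)%E.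
Proof. by rewrite /lebesgue_rV_step /pushforward measure_ge0. Qed.

Let mstep (A : set 'rV[R]_n.+1) : measurable A ->
  measurable (@rV_cons n @^-1` A).
Proof.
by move=> mA; rewrite -[X in measurable X]setTI; exact: measurable_rV_cons.
Qed.

Let step_sigma_additive : semi_sigma_additive lebesgue_rV_step.
Proof.
move=> F mF tF mUF; rewrite /lebesgue_rV_step /pushforward preimage_bigcup.
apply: measure_semi_sigma_additive.
- by move=> k; exact: mstep.
- apply/trivIsetP => /= i j _ _ ij; rewrite -preimage_setI.
  by move/trivIsetP : tF => /(_ _ _ _ _ ij) ->//; rewrite preimage_set0.
- by rewrite -preimage_bigcup; exact: mstep.
Qed.

HB.instance Definition _ := isMeasure.Build _ _ _ lebesgue_rV_step
  step0 step_ge0 step_sigma_additive.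

Let step_sigma_finite : sigma_finite setT lebesgue_rV_step.
Proof.
have [F [TF ndF Foo]] :=
  (sigma_finiteP _ _).1 (sigma_finiteT (@lebesgue_measure R)).
have [G [TG ndG Goo]] := (sigma_finiteP _ _).1 (sigma_finiteT mu).
pose un (x : 'rV[R]_n.+1) : measurableTypeR R * 'rV[R]_n :=
  (x ord0 ord0, \row_j x ord0 (lift ord0 j)).
have unK : cancel (@rV_cons n) un.
  move=> [a y]; rewrite /un /rV_cons; congr pair.
    by rewrite mxE unlift_none.
  by apply/rowP => j; rewrite !mxE liftK.
have mun : measurable_fun setT un.
  apply/measurable_fun_pairP; split; first exact: measurable_rV_coord.
  apply: measurability => //= A [B].
  rewrite -bigcup_seq => -[i _ [Y mY <-]] <-; rewrite !setTI.
  rewrite -comp_preimage -[X in measurable X]setTI.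
  rewrite (_ : _ \o _ = fun x : 'rV[R]_n.+1 => x ord0 (lift ord0 i)).
    exact: measurable_rV_coord.
  by apply/funext => x /=; rewrite mxE.
exists (fun k => un @^-1` (F k `*` G k)).
  rewrite -preimage_bigcup; apply/esym/seteqP; split => // x _ /=.
  have [i _ Fi] : (\bigcup_i F i) (un x).1 by rewrite -TF.
  have [j _ Gj] : (\bigcup_i G i) (un x).2 by rewrite -TG.
  exists (maxn i j) => //; split.
  - by move: Fi; exact/subsetPset/ndF/leq_maxl.
  - by move: Gj; exact/subsetPset/ndG/leq_maxr.
move=> k; have [mF Fk] := Foo k; have [mG Gk] := Goo k; split.
  by rewrite -[X in measurable X]setTI; apply: mun => //; exact: measurableX.
rewrite /lebesgue_rV_step /pushforward -comp_preimage.
rewrite (_ : un \o _ = id); last by apply/funext => x /=; rewrite unK.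
by rewrite preimage_id product_measure1E// lte_mul_pinfty// ge0_fin_numE.
Qed.

HB.instance Definition _ := Measure_isSigmaFinite.Build _ _ _
  lebesgue_rV_step step_sigma_finite.

End step.

(* Lebesgue measure on R^n (on the Borel sets): the product of the
   one-dimensional Lebesgue measure with the Lebesgue measure on R^(n-1),
   transported along R * R^(n-1) -> R^n; cf [lebesgue_rV_box]. *)
Fixpoint lebesgue_rV n : {sigma_finite_measure set 'rV[R]_n -> \bar R} :=
  match n with
  | 0 => dirac (0 : 'rV[R]_0)
  | k.+1 => lebesgue_rV_step (lebesgue_rV k)
  end.

Lemma lebesgue_rV_box n (A : 'I_n -> set R) : (forall i, measurable (A i)) ->
  lebesgue_rV n [set x | forall i, A i (x ord0 i)] =
  (\prod_(i < n) lebesgue_measure (A i))%E.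
Proof.
elim: n A => [|n IH] A mA.
  rewrite big_ord0 /= diracE mem_set//.
  by case.
rewrite big_ord_recl -IH//= /lebesgue_rV_step /pushforward.
rewrite -product_measure1E//; [|exact: mA|].
  congr ((_ \x _)%E _); apply/seteqP; split => [[a y] H|[a y] [Aa Hy] i].
    split; first by have := H ord0; rewrite mxE unlift_none.
    by move=> i; have := H (lift ord0 i); rewrite mxE liftK.
  by rewrite mxE; case: unliftP => [j ->|->] //=; exact: Hy.
rewrite [X in measurable X](_ : _ = \bigcap_(i in setT)
    ((fun x : 'rV[R]_n => x ord0 i) @^-1` A (lift ord0 i))).
  apply: fin_bigcap_measurable; first exact: finite_finset.
  by move=> i _; rewrite -[X in measurable X]setTI; exact: measurable_rV_coord.
by apply/seteqP; split => [x Ax i _|x Ax i]; exact: Ax.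
Qed.

End lebesgue_rV.

Section fields.
Context {R : realType} {d : nat}.

Definition Rn := 'rV[R]_d.
Definition sfield := Rn -> R.
Definition vfield := Rn -> 'rV[R]_d.

HB.instance Definition _ := GRing.Lmodule.on sfield.
HB.instance Definition _ := GRing.Lmodule.on vfield.

Definition fcoord m (i : 'I_m) (u : Rn -> 'rV[R]_m) : sfield :=
  fun x => u x ord0 i.

Definition mxdot m n (A B : 'M[R]_(m, n)) : R :=
  \sum_i \sum_j A i j * B i j.

Definition partial (i : 'I_d) (f : sfield) : sfield :=
  fun x => 'D_(delta_mx ord0 i) f x.

Definition smooth_on (U : set Rn) (f : sfield) : Prop :=
  forall (s : seq 'I_d) (x : Rn), U x ->
    {for x, continuous (foldr partial f s)} /\
    forall i, derivable (foldr partial f s) x (delta_mx ord0 i).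

Section domain.
Variable Omega : set Rn.

Definition bounded_domain : Prop :=
  [/\ Omega !=set0, open Omega, connected Omega & bounded_set Omega].

Definition test_function (phi : sfield) : Prop :=
  [/\ smooth_on setT phi, compact (closure [set x | phi x != 0])
    & closure [set x | phi x != 0] `<=` Omega].

Definition sdot (f g : sfield) : R :=
  \int[lebesgue_rV d]_(x in Omega) (f x * g x).

Definition mdot m n (u v : Rn -> 'M[R]_(m, n)) : R :=
  \int[lebesgue_rV d]_(x in Omega) mxdot (u x) (v x).

Definition snorm (f : sfield) : R := Num.sqrt (sdot f f).

Definition mnorm m n (u : Rn -> 'M[R]_(m, n)) : R := Num.sqrt (mdot u u).

Definition L2 (f : sfield) : Prop :=
  measurable_fun Omega f /\
  ((\int[lebesgue_rV d]_(x in Omega) (f x ^+ 2)%:E) < +oo)%E.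

Definition L2v m (u : Rn -> 'rV[R]_m) : Prop := forall i, L2 (fcoord i u).

Definition L20 (q : sfield) : Prop :=
  L2 q /\ (\int[lebesgue_rV d]_(x in Omega) q x) = 0.

Definition is_weak_partial (i : 'I_d) (f g : sfield) : Prop :=
  L2 g /\ forall phi, test_function phi ->
    sdot f (partial i phi) = - sdot g phi.

Definition H1 (f : sfield) : Prop :=
  L2 f /\ forall i, exists g, is_weak_partial i f g.

(* A representative of the a.e.-unique weak derivative (0 if there is none). *)
Definition weak_partial (i : 'I_d) (f : sfield) : sfield :=
  xget (fun=> 0) [set g | is_weak_partial i f g].

(* Closure of the test functions for the H^1 norm. *)
Definition H10 (f : sfield) : Prop :=
  H1 f /\ forall e, 0 < e -> exists2 phi, test_function phi &
    snorm (f - phi) ^+ 2 +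
      \sum_i snorm (weak_partial i f - partial i phi) ^+ 2 < e.

Definition H10v (u : vfield) : Prop := forall i, H10 (fcoord i u).

Definition grad (u : vfield) (x : Rn) : 'M[R]_d :=
  \matrix_(i, j) weak_partial j (fcoord i u) x.

Definition dvg (u : vfield) : sfield :=
  fun x => \sum_i weak_partial i (fcoord i u) x.

(* (u . grad) v, in row-vector form. *)
Definition advect (u v : vfield) : vfield := fun x => u x *m (grad v x)^T.

Definition bstar (u v w : vfield) : R :=
  2^-1 * mdot (advect u v) w - 2^-1 * mdot (advect u w) v.

(* The curl of [g : Rn -> R^3] is
     (curl g)_i = d_(i+1) g_(i+2) - d_(i+2) g_(i+1)   (indices modulo 3),
   with d_k = 0 for k >= d and only the components i < d retained. For d = 3
   this is the usual curl; for d = 2 it is the curl (d_1 g_2, - d_0 g_2) of the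
   scalar (out-of-plane) component g_2. *)
Definition partial_nat (k : nat) (f : sfield) : sfield :=
  if insub k is Some i then partial i f else fun=> 0.

Definition is_weak_curl (g : Rn -> 'rV[R]_3) (c : vfield) : Prop :=
  L2v c /\ forall phi, test_function phi -> forall i : 'I_d,
    let i1 := ((i + 1) %% 3)%N in let i2 := ((i + 2) %% 3)%N in
    sdot (fcoord i c) phi =
      - (\int[lebesgue_rV d]_(x in Omega)
           (g x ord0 (inord i2) * partial_nat i1 phi x -
            g x ord0 (inord i1) * partial_nat i2 phi x)).

Definition Hcurl (g : Rn -> 'rV[R]_3) : Prop :=
  L2v g /\ exists c, is_weak_curl g c.

Definition curl (g : Rn -> 'rV[R]_3) : vfield :=
  xget (fun=> 0) [set c | is_weak_curl g c].

End domain.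

(* Euclidean diameter. *)
Definition diameter (K : set Rn) : R :=
  sup [set Num.sqrt (mxdot (x - y) (x - y)) | x in K & y in K].

Record discretization := Discretization {
  ncells : nat;
  cell : 'I_ncells -> set Rn;
  Xh : set vfield;
  Qh : set sfield }.

Definition mesh_size (D : discretization) : R :=
  \big[Num.max/0]_(k < ncells D) diameter (cell k).

Definition mesh_of (Omega : set Rn) (D : discretization) : Prop :=
  [/\ forall k : 'I_(ncells D),
        [/\ cell k !=set0, open (cell k) & cell k `<=` Omega],
      forall k l : 'I_(ncells D), k != l -> cell k `&` cell l = set0 &
      (lebesgue_rV d).-negligible (Omega `\` \bigcup_k @cell D k)].

Definition finite_dim_subspace (V : lmodType R) (S : set V) : Prop :=
  exists N (e : 'I_N -> V),
    S = [set \sum_k c k *: e k | c in [set: 'I_N -> R]].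

Definition inf_sup (Omega : set Rn) (D : discretization) : Prop :=
  exists2 beta : R, 0 < beta & forall q, Qh D q ->
    beta * snorm Omega q <=
      sup [set sdot Omega q (dvg Omega v) / mnorm Omega (grad Omega v)
          | v in [set v | Xh D v /\ 0 < mnorm Omega (grad Omega v)]].

Record conforming_fe_pair (Omega : set Rn) (D : discretization) : Prop := {
  fe_mesh : mesh_of Omega D;
  fe_X_dim : finite_dim_subspace (Xh D);
  fe_Q_dim : finite_dim_subspace (Qh D);
  fe_X_piecewise : forall v, Xh D v ->
    forall k i, smooth_on (@cell D k) (fcoord i v);
  fe_Q_piecewise : forall q, Qh D q -> forall k, smooth_on (@cell D k) q;
  fe_X_conforming : Xh D `<=` H10v Omega;
  fe_Q_conforming : Qh D `<=` L20 Omega;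
  fe_inf_sup : inf_sup Omega D }.

End fields.

Arguments Rn : clear implicits.
Arguments sfield : clear implicits.
Arguments vfield : clear implicits.
Arguments discretization : clear implicits.

Section energy_map.
Context {R : realType}.

(* [F] and [G] are total functions, but they are only constrained on (0, +oo);
   they may be arbitrary elsewhere. *)
Record energy_map (F G : R -> R) : Prop := {
  F_increasing : forall x y, 0 < x -> x < y -> F x < F y;
  F_differentiable : forall x, 0 < x -> derivable F x 1;
  F_gt0 : forall x, 0 < x -> 0 < F x;
  G_gt0 : forall x, 0 < x -> 0 < G x;
  FK : forall x, 0 < x -> G (F x) = x;
  GK : forall x, 0 < x -> F (G x) = x }.

End energy_map.

Section time_sequences.
Context {R : realType} {V : lmodType R}.

(* [midpoint v n] is v^{n+1/2}; [extrap v n] is its extrapolation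
   2 v^{n-1/2} - v^{n-3/2}. *)
Definition midpoint (v : int -> V) (n : int) : V := 2^-1 *: (v (n + 1) + v n).

Definition extrap (v : int -> V) (n : int) : V :=
  2 *: midpoint v (n - 1) - midpoint v (n - 2).

End time_sequences.

Record mhd_parameters (R : realType) (J : nat) := MhdParameters {
  nu : 'I_J -> R;
  gamma : 'I_J -> R;
  coupling : R;
  alpha : R;
  alphaM : R;
  dt : R;
  C0 : R }.

(* [gpot] is the potential whose curl forces the magnetic field. [u_init] and
   [B_init] are the initial data entering the initial value of the auxiliary
   variable; the starting values of the multistep scheme are those of
   [member_approx] at nonpositive times. *)
Record member_data (R : realType) (d : nat) := MemberData {
  force : int -> vfield R d;
  gpot : int -> Rn R d -> 'rV[R]_3;
  u_init : vfield R d;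
  B_init : vfield R d }.

Record member_approx (R : realType) (d : nat) := MemberApprox {
  vel : int -> vfield R d;
  mag : int -> vfield R d;
  prs : int -> sfield R d;
  lam : int -> sfield R d;
  aux : nat -> R }.

Section scheme.
Context {R : realType} {d J : nat}.
Variables (Omega : set (Rn R d)) (D : discretization R d).
Variables (P : mhd_parameters R J) (F : R -> R).

Local Notation s := (coupling P).
Local Notation h := (mesh_size D).
Local Notation "<< u , v >>" := (mdot Omega u v).
Local Notation "<< p , q >>_s" := (sdot Omega p q).
Local Notation nabla := (grad Omega).
Local Notation div := (dvg Omega).
Local Notation b := (bstar Omega).

Definition ens_mean (c : 'I_J -> R) : R := (\sum_j c j) / J%:R.
Local Notation nu_ := (ens_mean (nu P)).
Local Notation gamma_ := (ens_mean (gamma P)).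
Definition fluct (c : 'I_J -> R) (j : 'I_J) : R := c j - ens_mean c.

Definition energy (u B : vfield R d) : R :=
  2^-1 * mnorm Omega u ^+ 2 + s / 2 * mnorm Omega B ^+ 2 + C0 P.

(* (velocity, magnetic field, pressure, magnetic multiplier) at one time level *)
Definition unknowns : Type :=
  (vfield R d * vfield R d * sfield R d * sfield R d)%type.
Definition uu (w : unknowns) : vfield R d := w.1.1.1.
Definition uB (w : unknowns) : vfield R d := w.1.1.2.
Definition up (w : unknowns) : sfield R d := w.1.2.
Definition ul (w : unknowns) : sfield R d := w.2.

HB.instance Definition _ := GRing.Lmodule.on unknowns.

Definition discrete (w : unknowns) : Prop :=
  [/\ Xh D (uu w), Xh D (uB w), Qh D (up w) & Qh D (ul w)].

Section step.
Variables (j : 'I_J) (dat : member_data R d) (sol : member_approx R d).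
Variable n : nat.

Local Notation un := (vel sol n).
Local Notation Bn := (mag sol n).
Local Notation ut := (extrap (vel sol) n).
Local Notation Bt := (extrap (mag sol) n).
Local Notation fn := (midpoint (force dat) n).
Local Notation cn := (curl Omega (midpoint (gpot dat) n)).

(* Throughout, [w] stands for the unknowns at level n+1. *)
Definition momentum (xi : R) (w : unknowns) : Prop :=
  forall v, Xh D v ->
    << (dt P)^-1 *: (uu w - un), v >> =
      - xi * b ut ut v + s * xi * b Bt Bt v
      - nu_ * << nabla (2^-1 *: (uu w + un)), nabla v >>
      - fluct (nu P) j * << nabla ut, nabla v >>
      + << 2^-1 *: (up w + prs sol n), div v >>_s
      - alpha P * h * << nabla (uu w - un), nabla v >>
      + << fn, v >>.

Definition induction (xi : R) (w : unknowns) : Prop :=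
  forall chi, Xh D chi ->
    << (dt P)^-1 *: (uB w - Bn), chi >> =
      xi * b Bt ut chi - xi * b ut Bt chi
      - gamma_ * << nabla (2^-1 *: (uB w + Bn)), nabla chi >>
      - fluct (gamma P) j * << nabla Bt, nabla chi >>
      + << 2^-1 *: (ul w + lam sol n), div chi >>_s
      - alphaM P * h * << nabla (uB w - Bn), nabla chi >>
      + << cn, chi >>.

Definition field_equations (xi : R) (w : unknowns) : Prop :=
  [/\ discrete w,
      momentum xi w, (forall l, Qh D l -> << div (uu w), l >>_s = 0),
      induction xi w & (forall psi, Qh D psi -> << div (uB w), psi >>_s = 0)].

Local Notation uh := (midpoint (vel sol) n).
Local Notation Bh := (midpoint (mag sol) n).
Local Notation ph := (midpoint (prs sol) n).
Local Notation lh := (midpoint (lam sol) n).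

(* [ub], [Bb] are the barred fields at level n+1. *)
Definition aux_equation (xi : R) (ub Bb : vfield R d) : Prop :=
  let ubh := 2^-1 *: (ub + un) in
  let Bbh := 2^-1 *: (Bb + Bn) in
  let S0 := << fn, ubh >> +
    (\int[lebesgue_rV d]_(x in Omega) (s * mxdot (cn x) (Bbh x))) in
  (F (aux sol n.+1) - F (aux sol n)) / dt P =
    << (dt P)^-1 *: (vel sol (n%:Z + 1) - un), uh >>
    + s * << (dt P)^-1 *: (mag sol (n%:Z + 1) - Bn), Bh >>
    + xi * b ut ut uh - s * xi * b Bt Bt uh
    + nu_ * mnorm Omega (nabla uh) ^+ 2
    + fluct (nu P) j * << nabla ut, nabla uh >>
    - << ph, div uh >>_s
    + alpha P * h * << nabla (vel sol (n%:Z + 1) - un), nabla uh >>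
    - << fn, uh >>
    - s * xi * b Bt ut Bh + s * xi * b ut Bt Bh
    + s * gamma_ * mnorm Omega (nabla Bh) ^+ 2
    + s * fluct (gamma P) j * << nabla Bt, nabla Bh >>
    - s * << lh, div Bh >>_s
    + s * alphaM P * h * << nabla (mag sol (n%:Z + 1) - Bn), nabla Bh >>
    - s * << cn, Bh >>
    + xi * (- (\int[lebesgue_rV d]_(x in Omega)
                 (nu P j * mxdot (nabla ubh x) (nabla ubh x) +
                  s * gamma P j * mxdot (nabla Bbh x) (nabla Bbh x))) + S0)
    + (1 - xi) * `|S0|.

(* [hat] and [brv] are the parts of the solution of the field equations that do
   not depend on xi: [hat + zeta *: brv] solves them with coefficient [zeta],
   whatever [zeta]. The barred fields are its value at [zeta = 1]. *)
Definition scheme_step : Prop :=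
  exists (xi : R) (hat brv : unknowns),
    let ub := uu hat + uu brv in
    let Bb := uB hat + uB brv in
    [/\ field_equations xi (vel sol (n%:Z + 1), mag sol (n%:Z + 1),
                            prs sol (n%:Z + 1), lam sol (n%:Z + 1)),
        [/\ discrete hat, discrete brv &
            forall zeta, field_equations zeta (hat + zeta *: brv)],
        {ae lebesgue_rV d, forall x, Omega x ->
           vel sol (n%:Z + 1) x = (uu hat + xi *: uu brv) x /\
           mag sol (n%:Z + 1) x = (uB hat + xi *: uB brv) x},
        xi = F (aux sol n.+1) / energy ub Bb &
        aux_equation xi ub Bb].

End step.

Definition admissible_data (dat : member_data R d) : Prop :=
  [/\ forall k : int, 0 <= k -> L2v Omega (force dat k),
      forall k : int, 0 <= k -> Hcurl Omega (gpot dat k),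
      L2v Omega (u_init dat) & L2v Omega (B_init dat)].

Definition admissible_start (sol : member_approx R d) : Prop :=
  [/\ forall k : int, -2 <= k <= 0 -> Xh D (vel sol k) /\ Xh D (mag sol k),
      Qh D (prs sol 0) & Qh D (lam sol 0)].

Definition zero_forcing (dat : member_data R d) : Prop :=
  forall n : nat,
    {ae lebesgue_rV d, forall x, Omega x ->
       midpoint (force dat) n x = 0 /\ curl Omega (midpoint (gpot dat) n) x = 0}.

End scheme.

(* Main.v *)
Require Import Defs.
From mathcomp Require Import all_boot all_order all_algebra.
From mathcomp Require Import all_classical all_reals all_analysis.
From mathcomp Require Import ring.
Set Implicit Arguments.
Unset Strict Implicit.
Unset Printing Implicit Defensive.
Import Order.TTheory GRing.Theory Num.Theory.
Import numFieldNormedType.Exports.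
Import HBNNSimple.
Local Open Scope classical_set_scope.
Local Open Scope ring_scope.

(** Test the momentum equation with the velocity midpoint and the induction
    equation with the magnetic midpoint, both of which lie in the discrete
    velocity space because it is a linear subspace. Up to the weight s on the
    magnetic part, the two resulting identities are exactly the terms by which
    the equation for the auxiliary variable was augmented, so all of them
    cancel, whatever the sign or size of the trilinear, fluctuation and pressure
    terms. Without forcing, all that survives is the dissipation that the
    auxiliary equation carries with weight xi ([aux_increment]):
      (F(R^{n+1}) - F(R^n)) / dt = - xi A,   A >= 0,
    where A is the viscous and resistive dissipation of the barred fields at the
    half step. As xi = F(R^{n+1}) / E with an energy E >= C0 > 0, this reads
      F(R^n) = (1 + dt A / E) F(R^{n+1}),
    a fully implicit decay step: F(R^{n+1}) is positive as soon as F(R^n) is,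
    and no larger ([implicit_decay]). Positivity starts from
    F(R^0) = F(G(E)) = E > 0 and propagates by induction. Nothing is asked of
    dt beyond its sign, which is why the stability is unconditional.

    The forcing terms are only zero almost everywhere, and the products that
    they enter are not a priori measurable; [Rintegral_ae0] shows that their
    integrals vanish all the same. *)

(** * Integrals of functions that vanish almost everywhere *)

(** The integral of a nonnegative function is a supremum over the simple
    functions below it. Such a simple function is itself zero almost everywhere,
    and it is measurable even if [f] and [A] are not. *)
Lemma ge0_integral_ae0 (dd : measure_display) (T : measurableType dd)
    (R : realType) (mu : {measure set T -> \bar R}) (A : set T)
    (f : T -> \bar R) :
  (forall x, 0 <= f x)%E -> {ae mu, forall x, A x -> f x = 0%E} ->
  (\int[mu]_(x in A) f x = 0)%E.
Proof.
move=> f0 fA0; rewrite integral_mkcond ge0_integralTE; last first.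
  by move=> x; rewrite /patch; case: ifP.
apply/eqP; rewrite eq_le; apply/andP; split.
- apply: ge_ereal_sup => _ /= [g gf <-].
  rewrite -integralT_nnsfun (ae_eq_integral (cst 0%E)) ?integral0//.
    by apply/measurable_realfun.measurable_EFinP.
  apply: filterS fA0 => x fx0 _ /=; apply/eqP.
  rewrite eq_le; apply/andP; split; last by rewrite lee_fin; exact: fun_ge0.
  by rewrite (le_trans (gf x))// /patch; case: ifPn => // /set_mem /fx0 ->.
- apply: ereal_sup_ubound; exists (cst_nnsfun T (@NngNum R 0 (lexx 0))).
    by move=> x /=; rewrite /patch; case: ifP.
  by rewrite -[RHS](sintegral0 mu).
Qed.

Lemma Rintegral_ae0 (dd : measure_display) (T : measurableType dd)
    (R : realType) (mu : {measure set T -> \bar R}) (A : set T) (f : T -> R) :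
  {ae mu, forall x, A x -> f x = 0} -> \int[mu]_(x in A) f x = 0.
Proof.
move=> f0; rewrite /Rintegral integralE.
rewrite ge0_integral_ae0; [|by move=> x; exact: funepos_ge0|]; last first.
  by apply: filterS f0 => x fx0 Ax; rewrite funeposE fx0// maxxx.
rewrite ge0_integral_ae0; [|by move=> x; exact: funeneg_ge0|]; last first.
  by apply: filterS f0 => x fx0 Ax; rewrite funenegE fx0// oppe0 maxxx.
by rewrite sube0.
Qed.

(** * The L^2 inner product *)

Section mxdot_theory.
Context {R : realType}.

Lemma mxdot_ge0 m n (A : 'M[R]_(m, n)) : 0 <= mxdot A A.
Proof.
by apply: sumr_ge0 => i _; apply: sumr_ge0 => k _; rewrite -expr2 sqr_ge0.
Qed.

Lemma mxdot0l m n (B : 'M[R]_(m, n)) : mxdot 0 B = 0.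
Proof.
by rewrite /mxdot big1// => i _; rewrite big1// => k _; rewrite mxE mul0r.
Qed.

Lemma mdot_ge0 d (Omega : set (Rn R d)) m n (u : Rn R d -> 'M[R]_(m, n)) :
  0 <= mdot Omega u u.
Proof. by apply: Rintegral_ge0 => x _; exact: mxdot_ge0. Qed.

(** The square root in [mnorm] truncates negative arguments to 0; the
    identity relies on [mdot u u] being nonnegative. *)
Lemma mnorm_sqr d (Omega : set (Rn R d)) m n (u : Rn R d -> 'M[R]_(m, n)) :
  mnorm Omega u ^+ 2 = mdot Omega u u.
Proof. by rewrite sqr_sqrtr// mdot_ge0. Qed.

Lemma mdot_ae0l d (Omega : set (Rn R d)) m n (u v : Rn R d -> 'M[R]_(m, n)) :
  {ae lebesgue_rV d, forall x, Omega x -> u x = 0} -> mdot Omega u v = 0.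
Proof.
move=> u0; apply: Rintegral_ae0; apply: filterS u0 => x ux0 Ox.
by rewrite ux0// mxdot0l.
Qed.

End mxdot_theory.

(** * The discrete energy law *)

Lemma finite_dim_subspace_midpoint (R : realType) (V : lmodType R) (S : set V)
    (v w : V) :
  finite_dim_subspace S -> S v -> S w -> S (2^-1 *: (v + w)).
Proof.
move=> [N [e ->]] [a _ <-] [b _ <-]; exists (fun k => 2^-1 * (a k + b k)) => //.
rewrite -big_split scaler_sumr /=; apply: eq_bigr => k _.
by rewrite -scalerDl scalerA.
Qed.

Section energy_decay.
Context {R : realType} {d J : nat}.
Variables (Omega : set (Rn R d)) (D : discretization R d).
Variables (P : mhd_parameters R J) (F : R -> R).
Hypotheses (hs : 0 < coupling P) (hC0 : 0 < C0 P).

Lemma energy_gt0 u B : 0 < energy Omega P u B.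
Proof.
rewrite /energy ltr_wpDl// addr_ge0// mulr_ge0 ?sqr_ge0//.
by rewrite divr_ge0// ltW.
Qed.

(** In the scheme, [u] and [B] are the barred fields at the half step. *)
Definition dissipation (j : 'I_J) (u B : vfield R d) : R :=
  \int[lebesgue_rV d]_(x in Omega)
    (nu P j * mxdot (grad Omega u x) (grad Omega u x) +
     coupling P * gamma P j * mxdot (grad Omega B x) (grad Omega B x)).

Lemma dissipation_ge0 j u B : 0 < nu P j -> 0 < gamma P j ->
  0 <= dissipation j u B.
Proof.
move=> nu0 gamma0; apply: Rintegral_ge0 => x _.
by rewrite addr_ge0// !mulr_ge0 ?mxdot_ge0// ltW.
Qed.

(** Level 0 is a starting value, whereas every later level is produced by a
    step of the scheme. *)
Lemma discrete_levels (sol : member_approx R d) :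
  admissible_start D sol ->
  (forall n : nat, Xh D (vel sol (n%:Z + 1)) /\ Xh D (mag sol (n%:Z + 1))) ->
  forall n : nat, Xh D (vel sol n) /\ Xh D (mag sol n).
Proof.
move=> [start _ _] step [|n]; first exact: start.
by have := step n; rewrite -PoszD addn1.
Qed.

(** The augmented terms of the auxiliary equation are the residuals of the
    momentum and induction equations tested with the midpoints, so they cancel
    identically and leave only the dissipation weighted by [xi]. *)
Lemma aux_increment j dat (sol : member_approx R d) (n : nat) xi ub Bb :
  finite_dim_subspace (Xh D) ->
  Xh D (vel sol n) -> Xh D (mag sol n) ->
  {ae lebesgue_rV d, forall x, Omega x ->
       midpoint (force dat) n x = 0 /\
       curl Omega (midpoint (gpot dat) n) x = 0} ->
  field_equations Omega D P j dat sol n xi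
    (vel sol (n%:Z + 1), mag sol (n%:Z + 1),
     prs sol (n%:Z + 1), lam sol (n%:Z + 1)) ->
  aux_equation Omega D P F j dat sol n xi ub Bb ->
  (F (aux sol n.+1) - F (aux sol n)) / dt P =
    - xi * dissipation j (2^-1 *: (ub + vel sol n)) (2^-1 *: (Bb + mag sol n)).
Proof.
move=> finX Xun XBn zero [[Xu XB _ _] mom _ ind _].
rewrite /uu /uB /= in Xu XB.
have f0 v : mdot Omega (midpoint (force dat) n) v = 0.
  by apply: mdot_ae0l; apply: filterS zero => x + Ox => /(_ Ox)[].
have c0 v : mdot Omega (curl Omega (midpoint (gpot dat) n)) v = 0.
  by apply: mdot_ae0l; apply: filterS zero => x + Ox => /(_ Ox)[].
have cs0 (v : vfield R d) : \int[lebesgue_rV d]_(x in Omega)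
    (coupling P * mxdot (curl Omega (midpoint (gpot dat) n) x) (v x)) = 0.
  apply: Rintegral_ae0; apply: filterS zero => x + Ox => /(_ Ox)[_ cx0].
  by rewrite cx0 mxdot0l mulr0.
have Xuh : Xh D (midpoint (vel sol) n) by exact: finite_dim_subspace_midpoint.
have XBh : Xh D (midpoint (mag sol) n) by exact: finite_dim_subspace_midpoint.
have := mom _ Xuh; have := ind _ XBh.
rewrite /uu /uB /up /ul /aux_equation /=.
rewrite -/(midpoint (mag sol) n) -/(midpoint (vel sol) n).
rewrite -/(midpoint (prs sol) n) -/(midpoint (lam sol) n).
rewrite cs0 -/(dissipation j _ _).
have := f0 (midpoint (vel sol) n).
have := f0 (2^-1 *: (ub + vel sol n)).
have := c0 (midpoint (mag sol) n).
have := mnorm_sqr Omega (grad Omega (midpoint (vel sol) n)).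
have := mnorm_sqr Omega (grad Omega (midpoint (mag sol) n)).
(* What is left is an identity between scalars. The forms become scalar
   unknowns, as comparing two of them would unfold the integrals. *)
repeat match goal with
| |- context [mdot ?O ?u ?v] => generalize (mdot O u v)
| |- context [sdot ?O ?u ?v] => generalize (sdot O u v)
| |- context [mnorm ?O ?u] => generalize (mnorm O u)
| |- context [bstar ?O ?u ?v ?w] => generalize (bstar O u v w)
| |- context [dissipation ?i ?u ?v] => generalize (dissipation i u v)
end.
do 20!move=> ?.
(* In order: the two squared norms, the three forcing terms, and the induction,
   momentum and auxiliary equations. *)
move=> <- <- -> -> -> -> -> ->.
by rewrite !addr0 normr0; ring.
Qed.

End energy_decay.

(** The equation rearranges to [a = b * (1 + t * A / e)], whose factor is at
    least 1. The weight [b / e] of the dissipation [A] is taken at the new value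
    [b]; with [a / e] instead, [b] would not be positive
    once [t * A >= e]. *)
Lemma implicit_decay (R : realFieldType) (a b t e A : R) :
  0 < t -> 0 < e -> 0 <= A -> 0 < a -> (b - a) / t = - (b / e) * A ->
  0 < b /\ b <= a.
Proof.
move=> t0 e0 A0 a0 H.
have k0 : 0 <= t * A / e by rewrite divr_ge0 ?mulr_ge0// ltW.
have ab : a = b * (1 + t * A / e).
  have -> : a = b - t * ((b - a) / t) by field; rewrite gt_eqF.
  by rewrite H; field; rewrite gt_eqF.
have k1 : 0 < 1 + t * A / e by rewrite ltr_pwDl.
have b0 : 0 < b by rewrite ab pmulr_lgt0 in a0.
by split=> //; rewrite ab ler_peMr ?lerDl// ltW.
Qed.

Theorem theorem5 (R : realType) (d J : nat)
  (Omega : set (Rn R d)) (D : discretization R d)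
  (P : mhd_parameters R J) (F G : R -> R)
  (dat : 'I_J -> member_data R d) (sol : 'I_J -> member_approx R d)
  (hd : d = 2%N \/ d = 3%N)
  (hOmega : bounded_domain Omega)
  (hD : conforming_fe_pair Omega D)
  (hnu : forall j, 0 < nu P j) (hgamma : forall j, 0 < gamma P j)
  (hs : 0 < coupling P) (halpha : 0 <= alpha P) (halphaM : 0 <= alphaM P)
  (hdt : 0 < dt P) (hC0 : 0 < C0 P)
  (hFG : energy_map F G)
  (hdat : forall j, admissible_data Omega (dat j))
  (hzero : forall j, zero_forcing Omega (dat j))
  (hstart : forall j, admissible_start D (sol j))
  (haux0 : forall j,
    aux (sol j) 0 = G (energy Omega P (u_init (dat j)) (B_init (dat j))))
  (hscheme : forall j n, scheme_step Omega D P F j (dat j) (sol j) n) :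
  forall j n,
    0 < F (aux (sol j) n.+1) /\ F (aux (sol j) n.+1) <= F (aux (sol j) n).
Proof.
move=> j.
have X1 (n : nat) : Xh D (vel (sol j) (n%:Z + 1)) /\ Xh D (mag (sol j) (n%:Z + 1)).
  by have [xi [hat [brv [[[]]]]]] := hscheme j n.
have X := discrete_levels (hstart j) X1.
have step n : 0 < F (aux (sol j) n) ->
    0 < F (aux (sol j) n.+1) /\ F (aux (sol j) n.+1) <= F (aux (sol j) n).
  have [xi [hat [brv [eqs _ _ xiE auxE]]]] := hscheme j n.
  have [Xu XB] := X n => F0.
  have := aux_increment (fe_X_dim hD) Xu XB (hzero j n) eqs auxE.
  rewrite xiE; apply: implicit_decay => //; first exact: energy_gt0.
  exact: dissipation_ge0.
suff pos n : 0 < F (aux (sol j) n) by move=> n; exact: step.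
elim: n => [|n /step[]//].
by rewrite haux0 (GK hFG); exact: energy_gt0.
Qed.
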